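(* Let $\Omega$ be a set, and consider either (i) the protocol of identically priced trials with a coherent cone $\mathcal{F}$ of real-valued functions on $\Omega$, or (ii) the protocol of Markov trials with, for each $\omega\in\Omega$, a coherent cone $\mathcal{F}(\omega)$ of real-valued functions on $\Omega$. Suppose that $E\subseteq\Omega^\infty$ is an invariant event. Then, in either protocol, $E$ is certain, impossible, or fully uncertain; that is, $\underline{\mathbb{P}}(E)=1$, or $\overline{\mathbb{P}}(E)=0$, or both $\underline{\mathbb{P}}(E)=0$ and $\overline{\mathbb{P}}(E)=1$.
   Context: A coherent cone on $\Omega$ is a non-empty set $\mathcal{F}$ of real-valued functions on $\Omega$ such that: (1) $F_1,F_2\in\mathcal{F}$ implies $F_1+F_2\in\mathcal{F}$; (2) $c\ge 0$ and $F\in\mathcal{F}$ imply $cF\in\mathcal{F}$; (3) there is no $F\in\mathcal{F}$ with $F(\omega)>0$ for all $\omega\in\Omega$. An event is an arbitrary subset of the set $\Omega^\infty$ of all infinite sequences of elements of $\Omega$ (no measurability is required). The shift $\theta:\Omega^\infty\to\Omega^\infty$ deletes the first element of a sequence. An event $E$ is invariant if $E=\theta^{-1}E$. Protocol of identically priced trials (parameters $\Omega$, $\mathcal{F}$): $\mathcal{K}_0=1$; on each trial $n=1,2,\ldots$ Skeptic announces $F_n\in\mathcal{F}$, then Reality announces $\omega_n\in\Omega$, and $\mathcal{K}_n:=\mathcal{K}_{n-1}+F_n(\omega_n)$. A strategy for Skeptic specifies each $F_n\in\mathcal{F}$ as a function of $\omega_1\ldots\omega_{n-1}$; then $\mathcal{K}_n$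 is a function of $\omega_1\ldots\omega_n$. A strategy is prudent if $\mathcal{K}_n(\omega_1\ldots\omega_n)\ge 0$ for all $\omega_1\omega_2\ldots\in\Omega^\infty$ and all $n$. The upper probability $\overline{\mathbb{P}}(E)$ is the infimum of all $\epsilon>0$ such that Skeptic has a prudent strategy for which $\sup_{n=1,2,\ldots}\mathcal{K}_n(\omega_1\ldots\omega_n)\ge 1/\epsilon$ for all $\omega_1\omega_2\ldots\in E$. Protocol of Markov trials (parameters $\Omega$, $(\mathcal{F}(\omega))_{\omega\in\Omega}$): Reality first announces $\omega_0\in\Omega$; $\mathcal{K}_0=1$; on each trial $n=1,2,\ldots$ Skeptic announces $F_n\in\mathcal{F}(\omega_{n-1})$, then Reality announces $\omega_n\in\Omega$, and $\mathcal{K}_n:=\mathcal{K}_{n-1}+F_n(\omega_n)$. A strategy for Skeptic specifies each $F_n\in\mathcal{F}(\omega_{n-1})$ as a function of $\omega_0\omega_1\ldots\omega_{n-1}$; then $\mathcal{K}_n$ is a function of $\omega_0\omega_1\ldots\omega_n$. A strategy is prudent if $\mathcal{K}_n(\omega_0\omega_1\ldots\omega_n)\ge 0$ for all $\omega_0\omega_1\omega_2\ldots\in\Omega^\infty$ and all $n$. In this protocol $\overline{\mathbb{P}}(E)$ is the infimum of all $\epsilon>0$ such that Skeptic has a prudent strategy for which $\sup_{n=1,2,\ldots}\mathcal{K}_n(\omega_0\omega_1\ldots\omega_n)\ge 1/\epsilon$ for all $\omega_0\omega_1\omega_2\ldots\in E$. In either protocol the lower probability is $\underline{\mathbb{P}}(E):=1-\overline{\mathbb{P}}(E^c)$,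 where $E^c=\Omega^\infty\setminus E$. $E$ is certain if $\underline{\mathbb{P}}(E)=1$, impossible if $\overline{\mathbb{P}}(E)=0$, and fully uncertain if $\underline{\mathbb{P}}(E)=0$ and $\overline{\mathbb{P}}(E)=1$. *)

(* Defs.v *)
From mathcomp Require Import all_boot all_order all_algebra.
From mathcomp Require Import all_classical all_reals all_analysis.

Set Implicit Arguments.
Unset Strict Implicit.
Unset Printing Implicit Defensive.

Import Order.TTheory GRing.Theory Num.Theory.

Local Open Scope classical_set_scope.
Local Open Scope ring_scope.

Record coherent_cone (R : realType) (Omega : Type)
    (F : set (Omega -> R)) : Prop := CoherentCone {
  cone_nonempty : F !=set0;
  cone_add : forall F1 F2, F F1 -> F F2 -> F (F1 \+ F2);
  cone_scale : forall (c : R) F1, 0 <= c -> F F1 -> F (fun x => c * F1 x);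
  cone_coherent : ~ exists2 F1, F F1 & forall x, 0 < F1 x }.

Definition shift_seq (Omega : Type) (w : nat -> Omega) : nat -> Omega :=
  fun n => w n.+1.

Definition invariant_event (Omega : Type) (E : set (nat -> Omega)) : Prop :=
  E = @shift_seq Omega @^-1` E.

(* Capital processes [K w n] give Skeptic's capital after trial [n] when Reality
   plays [w]; [w] is $\omega_1\omega_2\ldots$ (so [w n] is $\omega_{n+1}$) for
   identically priced trials, and $\omega_0\omega_1\ldots$ (so [w n] is
   $\omega_n$) for Markov trials. *)
Definition prudent (R : realType) (Omega : Type)
    (K : (nat -> Omega) -> nat -> R) : Prop :=
  forall w n, 0 <= K w n.

(* [KS] is the set of capital processes of all strategies of the protocol. The
   supremum over n = 1, 2, ... is taken in the extended reals since it may be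
   infinite; so is the infimum, in order to avoid default values. *)
Definition upper_prob (R : realType) (Omega : Type)
    (KS : set ((nat -> Omega) -> nat -> R)) (E : set (nat -> Omega)) : \bar R :=
  ereal_inf [set eps%:E | eps in [set eps : R | 0 < eps /\
    exists K, [/\ KS K, prudent K & forall w, E w ->
      ((1 / eps)%:E <= ereal_sup (range (fun n => (K w n.+1)%:E)))%E]]].

Definition lower_prob (R : realType) (Omega : Type)
    (KS : set ((nat -> Omega) -> nat -> R)) (E : set (nat -> Omega)) : \bar R :=
  (1 - upper_prob KS (~` E))%E.

Definition certain (R : realType) (Omega : Type)
    (KS : set ((nat -> Omega) -> nat -> R)) (E : set (nat -> Omega)) : Prop :=
  lower_prob KS E = 1%E.

Definition impossible (R : realType) (Omega : Type)
    (KS : set ((nat -> Omega) -> nat -> R)) (E : set (nat -> Omega)) : Prop :=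
  upper_prob KS E = 0%E.

Definition fully_uncertain (R : realType) (Omega : Type)
    (KS : set ((nat -> Omega) -> nat -> R)) (E : set (nat -> Omega)) : Prop :=
  lower_prob KS E = 0%E /\ upper_prob KS E = 1%E.

(* [S [:: w_1; ...; w_(n-1)]] is the move $F_n$. *)
Definition idpriced_strategy (R : realType) (Omega : Type) (F : set (Omega -> R))
    (S : seq Omega -> Omega -> R) : Prop :=
  forall s, F (S s).

Fixpoint idpriced_capital (R : realType) (Omega : Type)
    (S : seq Omega -> Omega -> R) (w : nat -> Omega) (n : nat) : R :=
  if n is m.+1 then idpriced_capital S w m + S (mkseq w m) (w m) else 1.

Definition idpriced_capitals (R : realType) (Omega : Type) (F : set (Omega -> R)) :
    set ((nat -> Omega) -> nat -> R) :=
  [set idpriced_capital S | S in idpriced_strategy F].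

(* [S w_0 [:: w_1; ...; w_(n-1)]] is the move $F_n$; the last outcome announced
   before it, $\omega_{n-1}$, is [last w_0 [:: w_1; ...; w_(n-1)]]. *)
Definition markov_strategy (R : realType) (Omega : Type)
    (F : Omega -> set (Omega -> R)) (S : Omega -> seq Omega -> Omega -> R) :
    Prop :=
  forall w0 s, F (last w0 s) (S w0 s).

Fixpoint markov_capital (R : realType) (Omega : Type)
    (S : Omega -> seq Omega -> Omega -> R) (w : nat -> Omega) (n : nat) : R :=
  if n is m.+1 then
    markov_capital S w m + S (w 0%N) (mkseq (shift_seq w) m) (w m.+1)
  else 1.

Definition markov_capitals (R : realType) (Omega : Type)
    (F : Omega -> set (Omega -> R)) : set ((nat -> Omega) -> nat -> R) :=
  [set markov_capital S | S in markov_strategy F].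

(* Main.v *)
Require Import Defs.
From mathcomp Require Import all_boot all_order all_algebra.
From mathcomp Require Import all_classical all_reals all_analysis.
From mathcomp Require Import lra.

(** The heart of the matter is that the upper probability of an invariant
    event is either 0 or 1 ([markov_upper_prob01]); applied to the event and
    to its complement, which is invariant too, this yields the trichotomy
    ([trichotomy_of_upper_prob01]).

    The upper probability is at most 1 since Skeptic may always do nothing.
    Suppose that it is less than 1.  Then there are a prudent strategy and a
    level c > 1 such that the capital exceeds c at some time on every path of
    the event.  Skeptic plays this strategy until his capital exceeds c, and
    then starts it afresh from the present outcome, with all stakes multiplied
    by the capital reached.  The part of the path that lies ahead is again a
    path of the event, by invariance, so the capital will once more be
    multiplied by more than c, and so on.  On the event the capital of the
    restarted strategy is therefore unbounded ([restart_unbounded]), so that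
    this single strategy shows that the upper probability is 0.

    This argument is carried out for Markov trials.  Identically priced
    trials are Markov trials with a constant family of cones, except for the
    initial outcome; since adding or deleting an outcome at the front of a path
    does not affect its membership in an invariant event, the two upper
    probabilities of such an event agree ([idpriced_upper_prob_markov]). *)

Set Implicit Arguments.
Unset Strict Implicit.
Unset Printing Implicit Defensive.

Import Order.TTheory GRing.Theory Num.Theory.

Local Open Scope classical_set_scope.
Local Open Scope ring_scope.

(** * Coherent cones, invariant events and upper probability *)

Lemma coherent_cone0 (R : realType) (Omega : Type) (F : set (Omega -> R)) :
  coherent_cone F -> F (fun=> 0).
Proof.
case=> [[f Ff] _ scaleF _]; have := scaleF 0 f (lexx 0) Ff.
by under eq_fun do rewrite mul0r.
Qed.

Lemma invariant_shift (Omega : Type) (E : set (nat -> Omega)) :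
  invariant_event E -> forall w, E (shift_seq w) <-> E w.
Proof.
move=> hE w; have : E w = E (shift_seq w) := congr1 (@^~ w) hE.
by move=> ->.
Qed.

Lemma invariantC (Omega : Type) (E : set (nat -> Omega)) :
  invariant_event E -> invariant_event (~` E).
Proof. by move=> hE; rewrite /invariant_event -preimage_setC -hE. Qed.

Lemma invariant_tail (Omega : Type) (E : set (nat -> Omega)) w n :
  invariant_event E -> E w -> E (fun i => w (n + i)%N).
Proof.
move=> hE; elim: n w => [|n IHn] w Ew; first exact: Ew.
exact: (IHn (shift_seq w) ((invariant_shift hE w).2 Ew)).
Qed.

Section UpperProbability.
Context (R : realType) (Omega : Type).
Variable KS : set ((nat -> Omega) -> nat -> R).
Implicit Types E : set (nat -> Omega).

Lemma upper_prob_ge0 E : (0 <= upper_prob KS E)%E.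
Proof.
by apply: le_ereal_inf_tmp => _ [eps [eps_gt0 _] <-]; rewrite lee_fin ltW.
Qed.

Lemma upper_prob_le1 E : KS (fun _ _ => 1) -> (upper_prob KS E <= 1)%E.
Proof.
move=> KS1; apply: ereal_inf_lbound; exists 1 => //; split => //.
exists (fun _ _ => 1); split => // w _.
by rewrite divr1; apply: ereal_sup_ubound; exists 0%N.
Qed.

(** The level c is strictly between 1 and the supremum 1/eps, so that it is
    exceeded at some time even if the supremum is not attained. *)
Lemma upper_prob_lt1 E : (upper_prob KS E < 1)%E ->
  exists K c, [/\ KS K, prudent K, 1 < c
    & forall w, E w -> exists n, c < K w n.+1].
Proof.
move=> /ereal_inf_lt[_ [eps [eps_gt0 [K [KSK K_ge0 supK]]] <-]].
rewrite lte_fin => eps_lt1.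
have inv_gt1 : 1 < 1 / eps by rewrite ltr_pdivlMr// mul1r.
exists K, ((1 + 1 / eps) / 2); split => // [|w Ew]; first by lra.
have : (((1 + 1 / eps) / 2)%:E < ereal_sup (range (fun n => (K w n.+1)%:E)))%E.
  by apply: lt_le_trans (supK w Ew); rewrite lte_fin; lra.
by move=> /ereal_sup_gt[_ [n _ <-]]; rewrite lte_fin => ?; exists n.
Qed.

Lemma upper_prob_eq0 E K : KS K -> prudent K ->
  (forall w B, E w -> exists n, B <= K w n.+1) -> upper_prob KS E = 0%E.
Proof.
move=> KSK K_ge0 unbounded; apply/eqP; rewrite eq_le upper_prob_ge0 andbT.
apply/lee_addgt0Pr => eps eps_gt0; rewrite add0e.
apply: ereal_inf_lbound; exists eps => //; split => //.
exists K; split => // w Ew; have [n len] := unbounded w (1 / eps) Ew.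
by apply: le_ereal_sup_tmp; exists (K w n.+1)%:E; [exists n | rewrite lee_fin].
Qed.

Lemma trichotomy_of_upper_prob01 E :
  (forall E', invariant_event E' ->
     upper_prob KS E' = 0%E \/ upper_prob KS E' = 1%E) ->
  invariant_event E ->
  [\/ certain KS E, impossible KS E | fully_uncertain KS E].
Proof.
move=> P01 hE; have [PE|PE] := P01 E hE; first exact: Or32.
rewrite /certain /fully_uncertain /lower_prob.
have [PC|PC] := P01 _ (invariantC hE); rewrite PC.
  by apply: Or31; rewrite sube0.
by apply: Or33; rewrite subee.
Qed.

End UpperProbability.

(** * Capital along a finite path *)

Section MarkovCapital.
Context (R : realType) (Omega : Type).
Variable S : Omega -> seq Omega -> Omega -> R.
Implicit Types (w : nat -> Omega) (x y : Omega) (h s : seq Omega).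

Lemma eq_markov_capital w w' n : (forall i, (i <= n)%N -> w i = w' i) ->
  markov_capital S w n = markov_capital S w' n.
Proof.
elim: n => [//|n IHn] eqw /=; rewrite IHn => [|i le_in]; last first.
  by apply: eqw; rewrite leqW.
rewrite !eqw//; congr (_ + S _ _ _).
apply/eq_in_map => i; rewrite mem_iota add0n => /andP[_ lt_in].
by apply: (eqw i.+1); rewrite ltnS ltnW.
Qed.

(** Skeptic's capital once Reality has announced the outcome [x] and then
    those of [h].  The finite path is completed to an infinite one so that
    prudence applies to it directly. *)
Definition path_capital x h : R := markov_capital S (nth x (x :: h)) (size h).

Lemma path_capital_ge0 x h : prudent (markov_capital S) -> 0 <= path_capital x h.
Proof. exact. Qed.

Lemma path_capital_rcons x h y :
  path_capital x (rcons h y) = path_capital x h + S x h y.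
Proof.
rewrite /path_capital size_rcons /=; congr (_ + S _ _ _).
- by apply: eq_markov_capital => -[//|i] lt_ih /=; rewrite nth_rcons lt_ih.
- apply: (@eq_from_nth _ x); rewrite size_mkseq// => i lt_ih.
  by rewrite nth_mkseq// /shift_seq /= nth_rcons lt_ih.
- by rewrite nth_rcons ltnn eqxx.
Qed.

Lemma markov_capital_path w n :
  markov_capital S w n = path_capital (w 0%N) (mkseq (shift_seq w) n).
Proof.
rewrite /path_capital size_mkseq; apply: eq_markov_capital => -[//|i] lt_in /=.
by rewrite nth_mkseq.
Qed.

End MarkovCapital.

(** * Restarting a strategy whenever it succeeds *)

Section Restart.
Context (R : realType) (Omega : Type).
Variables (S : Omega -> seq Omega -> Omega -> R) (c : R).
Implicit Types (w : nat -> Omega) (x y : Omega) (h s : seq Omega).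

(** A state [(a, x, h)] consists of the capital [a] at the latest restart, the
    outcome [x] from which the strategy was then started, and the outcomes [h]
    announced since. *)
Definition restart_step (st : R * Omega * seq Omega) y : R * Omega * seq Omega :=
  let: (a, x, h) := st in
  if c < path_capital S x (rcons h y)
  then (a * path_capital S x (rcons h y), y, [::])
  else (a, x, rcons h y).

Definition restart_state x0 s := foldl restart_step (1, x0, [::]) s.

Definition restart x0 s y : R :=
  let: (a, x, h) := restart_state x0 s in a * S x h y.

Definition state_capital (st : R * Omega * seq Omega) : R :=
  let: (a, x, h) := st in a * path_capital S x h.

(** The last outcome is not lost at a restart; this makes the restarted strategy
    legal, since Skeptic's moves are constrained by that outcome. *)
Lemma restart_stateP x0 s : 1 < c ->
  let: (a, x, h) := restart_state x0 s in 0 < a /\ last x h = last x0 s.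
Proof.
move=> c_gt1; elim/last_ind: s => [|s y]; first by [].
rewrite /restart_state foldl_rcons -/(restart_state _ _).
case: (restart_state x0 s) => [[a x] h] [a_gt0 _] /=.
case: ifPn => [lt_cK|_]; rewrite !last_rcons; split => //.
by rewrite mulr_gt0// (lt_trans _ lt_cK)// (lt_trans ltr01).
Qed.

Lemma restart_strategy F : 1 < c -> (forall x, coherent_cone (F x)) ->
  markov_strategy F S -> markov_strategy F restart.
Proof.
move=> c_gt1 coneF SF x0 s; have := restart_stateP x0 s c_gt1; rewrite /restart.
case: (restart_state x0 s) => [[a x] h] [a_gt0 <-].
exact: (cone_scale (coneF _) (ltW a_gt0) (SF x h)).
Qed.

(** A restart leaves the capital unchanged: the factor [path_capital] is
    absorbed into the stake, and the strategy restarts from capital 1. *)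
Lemma restart_capital w n : markov_capital restart w n =
  state_capital (restart_state (w 0%N) (mkseq (shift_seq w) n)).
Proof.
elim: n => [|n IHn]; first by rewrite /= mul1r.
rewrite mkseqS /restart_state foldl_rcons -/(restart_state _ _) /= IHn /restart.
case: (restart_state _ _) => [[a x] h] /=.
by case: ifP => _ /=; rewrite ?[path_capital S _ [::]]/= ?mulr1
  path_capital_rcons mulrDr.
Qed.

Lemma restart_prudent : 1 < c -> prudent (markov_capital S) ->
  prudent (markov_capital restart).
Proof.
move=> c_gt1 S_ge0 w n; rewrite restart_capital.
have := restart_stateP (w 0%N) (mkseq (shift_seq w) n) c_gt1.
case: (restart_state _ _) => [[a x] h] [a_gt0 _] /=.
by rewrite mulr_ge0 ?path_capital_ge0// ltW.
Qed.

(** After a restart, the strategy [S] is copied along the remaining path until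
    its capital there first exceeds [c]; the factor [K] is the capital at that
    first passage, which is when the next restart takes place. *)
Lemma next_restart w n a : 1 < c ->
  restart_state (w 0%N) (mkseq (shift_seq w) n) = (a, w n, [::]) ->
  (exists m, c < markov_capital S (fun i => w (n + i)%N) m) ->
  exists m K, c < K /\
    restart_state (w 0%N) (mkseq (shift_seq w) m) = (a * K, w m, [::]).
Proof.
move=> c_gt1 start reach; pose v i := w (n + i)%N.
case: (ex_minnP reach) => -[|m] /= lt_cK minm.
  by rewrite ltNge (ltW c_gt1) in lt_cK.
(* no restart occurs before the first passage above c *)
have wait j : (j <= m)%N -> restart_state (w 0%N) (mkseq (shift_seq w) (n + j)) =
    (a, w n, mkseq (shift_seq v) j).
  elim: j => [|j IHj] lt_jm; first by rewrite addn0.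
  rewrite addnS mkseqS /restart_state foldl_rcons -/(restart_state _ _).
  rewrite (IHj (ltnW lt_jm)) /=.
  have -> : shift_seq w (n + j) = shift_seq v j by rewrite /shift_seq /v addnS.
  rewrite -mkseqS ifN//; apply: contraL lt_jm => lt_cj.
  have/minm : c < markov_capital S v j.+1.
    by rewrite markov_capital_path /v addn0.
  by rewrite -leqNgt ltnS.
exists (n + m.+1)%N, (markov_capital S v m.+1); split => //.
rewrite addnS mkseqS /restart_state foldl_rcons -/(restart_state _ _) wait//.
have -> : shift_seq w (n + m) = shift_seq v m by rewrite /shift_seq /v addnS.
have capE : markov_capital S v m.+1 =
    path_capital S (w n) (mkseq (shift_seq v) m.+1).
  by rewrite markov_capital_path /v addn0.
rewrite /restart_step -mkseqS -capE ifT//.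
by rewrite /shift_seq /v addnS.
Qed.

(** The stake is multiplied by at least [c] at every restart; as it is at
    least 1, it also grows by at least [c - 1], a bound that is enough. *)
Lemma restart_stake (E : set (nat -> Omega)) w k : invariant_event E -> 1 < c ->
  (forall v, E v -> exists n, c < markov_capital S v n.+1) -> E w ->
  exists n a, 1 + k%:R * (c - 1) <= a /\
    restart_state (w 0%N) (mkseq (shift_seq w) n) = (a, w n, [::]).
Proof.
move=> hE c_gt1 reach Ew; elim: k => [|k [n [a [le_a start]]]].
  by exists 0%N, 1; split => //; rewrite mul0r addr0.
have [m lt_cm] := reach _ (invariant_tail n hE Ew).
have [p [K [lt_cK restartE]]] := next_restart c_gt1 start (ex_intro _ m.+1 lt_cm).
exists p, (a * K); split => //; rewrite -natr1.
have : 0 <= k%:R * (c - 1) by rewrite mulr_ge0// subr_ge0 ltW.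
by move=> ?; nra.
Qed.

Lemma restart_unbounded (E : set (nat -> Omega)) w B :
  invariant_event E -> 1 < c ->
  (forall v, E v -> exists n, c < markov_capital S v n.+1) -> E w ->
  exists n, B <= markov_capital restart w n.+1.
Proof.
move=> hE c_gt1 reach Ew; set b := `|B| / (c - 1).
have b_ge0 : 0 <= b by rewrite divr_ge0// subr_ge0 ltW.
have [n [a [le_a start]]] := restart_stake (Num.bound b) hE c_gt1 reach Ew.
have := archi_boundP b_ge0; rewrite ltr_pdivrMr ?subr_gt0// => lt_B.
have capE : markov_capital restart w n = a.
  by rewrite restart_capital start /= [path_capital S _ _]/= mulr1.
move: le_a; rewrite -{}capE => le_a.
have B_ge0 : 0 <= `|B| by [].
have le_B := ler_norm B.
(* time 0 is excluded, as the capital is then 1 and not above 1 + `|B| *)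
case: n {start} le_a => [/=|n] le_a; first by lra.
by exists n; lra.
Qed.

End Restart.

(** * The zero-one law *)

Lemma markov_capitals1 (R : realType) (Omega : Type) (F : Omega -> set (Omega -> R)) :
  (forall x, coherent_cone (F x)) -> markov_capitals F (fun _ _ => 1).
Proof.
move=> coneF; exists (fun _ _ _ => 0) => [w0 s|].
  exact: coherent_cone0.
by apply/funext => w; apply/funext; elim=> //= n ->; rewrite addr0.
Qed.

Lemma markov_upper_prob01 (R : realType) (Omega : Type)
    (F : Omega -> set (Omega -> R)) (E : set (nat -> Omega)) :
  (forall x, coherent_cone (F x)) -> invariant_event E ->
  upper_prob (markov_capitals F) E = 0%E \/
  upper_prob (markov_capitals F) E = 1%E.
Proof.
move=> coneF hE; have := upper_prob_le1 E (markov_capitals1 coneF).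
rewrite le_eqVlt => /orP[/eqP|]; first by right.
move=> /upper_prob_lt1[_ [c [[S SF <-] S_ge0 c_gt1 reach]]]; left.
apply: (@upper_prob_eq0 _ _ _ _ (markov_capital (restart S c))).
- by exists (restart S c) => //; exact: restart_strategy.
- exact: restart_prudent.
- by move=> w B; exact: restart_unbounded.
Qed.

(** * Identically priced trials as Markov trials *)

Definition cons_seq (Omega : Type) (x : Omega) (w : nat -> Omega) : nat -> Omega :=
  fun n => if n is m.+1 then w m else x.

Lemma markov_capital_idpriced (R : realType) (Omega : Type)
    (S : seq Omega -> Omega -> R) w :
  markov_capital (fun=> S) w = idpriced_capital S (shift_seq w).
Proof. by apply/funext; elim=> //= n ->. Qed.

Lemma idpriced_capital_markov (R : realType) (Omega : Type)
    (S : Omega -> seq Omega -> Omega -> R) x w :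
  idpriced_capital (S x) w = markov_capital S (cons_seq x w).
Proof. by apply/funext; elim=> //= n ->. Qed.

(** A strategy for identically priced trials is a Markov strategy that ignores
    the initial outcome; conversely, a Markov strategy is played after an
    imaginary initial outcome, which exists because coherence forbids an empty
    outcome space. *)
Lemma idpriced_upper_prob_markov (R : realType) (Omega : Type)
    (F : set (Omega -> R)) (E : set (nat -> Omega)) :
  coherent_cone F -> invariant_event E ->
  upper_prob (idpriced_capitals F) E = upper_prob (markov_capitals (fun=> F)) E.
Proof.
move=> coneF hE.
have [x0] : exists x0 : Omega, True.
  apply/not_existsP => noOmega; case: (coneF) => -[f Ff] _ _; apply.
  by exists f => // x; case: (noOmega x).
move=> _; rewrite /upper_prob; congr ereal_inf; congr image.
apply/seteqP; split => eps [eps_gt0 [_ [[S SF <-] S_ge0 supS]]]; split => //.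
- exists (markov_capital (fun=> S)); split; first by exists (fun=> S) => // w0 s.
  + by move=> w n; rewrite markov_capital_idpriced.
  + move=> w Ew; rewrite markov_capital_idpriced.
    exact: supS ((invariant_shift hE w).2 Ew).
- exists (idpriced_capital (S x0)); split.
  + by exists (S x0) => // s; exact: (SF x0 s).
  + by move=> w n; rewrite idpriced_capital_markov.
  + move=> w Ew; rewrite idpriced_capital_markov; apply: supS.
    exact: (invariant_shift hE (cons_seq x0 w)).1.
Qed.

Theorem corollary1 (R : realType) (Omega : Type) (E : set (nat -> Omega))
    (hE : invariant_event E) :
  (forall F : set (Omega -> R), coherent_cone F ->
     [\/ certain (idpriced_capitals F) E, impossible (idpriced_capitals F) E
       | fully_uncertain (idpriced_capitals F) E]) /\
  (forall F : Omega -> set (Omega -> R), (forall w, coherent_cone (F w)) ->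
     [\/ certain (markov_capitals F) E, impossible (markov_capitals F) E
       | fully_uncertain (markov_capitals F) E]).
Proof.
split=> F coneF; apply: trichotomy_of_upper_prob01 => // E' hE'.
  by rewrite idpriced_upper_prob_markov//; exact: markov_upper_prob01.
exact: markov_upper_prob01.
Qed.
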